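(* Let $n$ be a positive integer. If there is an $n$-satisfactory coloring of $\mathbb Z^+$, then for every finite set $A$ of positive integers such that $|A|$ is odd, the symmetric difference of the sets $A,2\cdot A,\dots,n\cdot A$ has at least $n$ elements.
   Context: For a positive integer $n$, an $n$-satisfactory coloring of $\mathbb Z^+$ (the positive integers) is a coloring of $\mathbb Z^+$ using exactly $n$ colors such that for every positive integer $a$ the numbers $a,2a,\dots,na$ all receive different colors. For $k\in\mathbb Z^+$ and $A\subseteq\mathbb Z^+$, $k\cdot A=\{kx:x\in A\}$. The symmetric difference of finitely many sets $C_1,\dots,C_m$ is the set of elements that belong to precisely an odd number of the sets $C_l$, $1\le l\le m$. *)

(* Defs.v *)
From mathcomp Require Import all_boot finmap.

Set Implicit Arguments.
Unset Strict Implicit.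
Unset Printing Implicit Defensive.

Local Open Scope fset_scope.

(* A positive integer is a [x : nat] with [0 < x]; the value [c 0] of a
   colouring is never constrained.  The first clause says that every one of
   the [n] colours is used on the positive integers; in the second,
   [i.+1] and [j.+1] range over the multipliers 1, ..., n. *)
Definition satisfactory (n : nat) (c : nat -> 'I_n) : Prop :=
  (forall k : 'I_n, exists2 x : nat, 0 < x & c x = k) /\
  (forall a : nat, 0 < a ->
     forall i j : 'I_n, i != j -> c (i.+1 * a) != c (j.+1 * a)).

Definition dilate (k : nat) (A : {fset nat}) : {fset nat} :=
  [fset k * x | x in A].

(* Multiplicity is counted by index, so repeated sets count repeatedly. *)
Definition symdiff (K : choiceType) (m : nat) (C : 'I_m -> {fset K}) :
    {fset K} :=
  [fset x in \big[fsetU/fset0]_(l < m) C l | odd #|[set l : 'I_m | x \in C l]|].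

(* Main.v *)
Require Import Defs.
From mathcomp Require Import all_boot finmap.

(** Fix a colour [k] of a satisfactory colouring [c] and count the pairs
    [(l, a)] with [1 <= l <= n], [a] in [A] and [c (l * a) = k].  For each
    positive [a] the [n] numbers [a, 2a, ..., na] receive distinct colours out
    of [n], so exactly one of them has colour [k] ([one_multiple_per_colour]):
    there are [|A|] such pairs, an odd number.  Grouping the pairs by the value
    [x = l * a] instead, each [x] of colour [k] is counted as often as it lies
    in one of the dilates of [A].  Modulo 2 only the [x] of odd multiplicity
    matter, that is, those of the symmetric difference ([odd_count_symdiff]).
    So the symmetric difference has an odd number of elements of colour [k], in
    particular at least one.  It meets all [n] colours, hence has at least [n]
    elements. *)

Local Open Scope fset_scope.

Lemma odd_sum (I : Type) (r : seq I) (P : pred I) (F : I -> nat) :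
  odd (\sum_(i <- r | P i) F i) = \big[addb/false]_(i <- r | P i) odd (F i).
Proof. by apply: big_morph => // a b; rewrite oddD. Qed.

Lemma count_fsubset {K : choiceType} (P : pred K) {B U : {fset K}} :
  B `<=` U -> count P B = \sum_(x <- U | P x) (x \in B).
Proof.
move=> /fsubsetP sBU.
have /permP -> : perm_eq B [seq x <- U | x \in B].
  apply: uniq_perm; rewrite ?filter_uniq ?fset_uniq // => x.
  by rewrite mem_filter andb_idr // => /sBU.
rewrite count_filter -sum1_count [RHS]big_mkcond [LHS]big_mkcond.
by apply: eq_bigr => x _ /=; case: (P x); case: (x \in B).
Qed.

(** Double counting of the pairs [(l, x)] with [x] in [C l]: an [x] of even
    multiplicity contributes nothing modulo 2, one of odd multiplicity
    contributes 1. *)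
Lemma odd_count_symdiff (K : choiceType) (m : nat) (C : 'I_m -> {fset K})
    (P : pred K) :
  odd (count P (symdiff C)) = odd (\sum_(l < m) count P (C l)).
Proof.
rewrite /symdiff; set U := \big[fsetU/fset0]_(l < m) C l.
have sCU l : C l `<=` U by apply: bigfcup_sup.
rewrite (eq_bigr _ (fun l _ => count_fsubset P (sCU l))) exchange_big /=.
rewrite (count_fsubset P (fset_sub U _)) !odd_sum.
rewrite big_seq_cond [RHS]big_seq_cond; apply: eq_bigr => x /andP[xU _].
rewrite !inE /= xU oddb -sum1_card.
congr odd; rewrite big_mkcond; apply: eq_bigr => l _ /=.
by rewrite inE; case: (x \in C l).
Qed.

(** The colours of [a, 2a, ..., na] form an injective, hence bijective, map
    between two sets of [n] elements. *)
Lemma one_multiple_per_colour {n : nat} {c : nat -> 'I_n} (a : nat)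
    (k : 'I_n) :
  satisfactory c -> 0 < a -> \sum_(l < n) (c (l.+1 * a) == k) = 1.
Proof.
move=> [_ c_neq] a_gt0.
have c_inj : injective (fun l : 'I_n => c (l.+1 * a)).
  by move=> i j /eqP cij; apply: contraTeq cij => /(c_neq a a_gt0).
have [d cK dK] := injF_bij c_inj.
rewrite (bigD1 (d k)) //= dK eqxx big1 // => l l_neq.
by apply/eqP; rewrite eqb0; apply: contraNneq l_neq => <-;
  rewrite -{1}(cK l).
Qed.

Lemma count_dilate (l : nat) (A : {fset nat}) (P : pred nat) :
  count P (dilate l.+1 A) = \sum_(x <- A) P (l.+1 * x).
Proof.
have mul_inj : injective (muln l.+1).
  by move=> x y /eqP; rewrite eqn_pmul2l // => /eqP.
have /permP -> : perm_eq (dilate l.+1 A) [seq l.+1 * x | x <- A].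
  apply: uniq_perm; rewrite ?fset_uniq ?map_inj_uniq ?fset_uniq // => x.
  by apply/imfsetP/mapP => -[y yA ->]; exists y.
by rewrite count_map -sum1_count big_mkcond; apply: eq_bigr => x _ /=; case: P.
Qed.

Lemma leq_card_colours (K : choiceType) (n : nat) (c : K -> 'I_n)
    (D : {fset K}) :
  (forall k, has (fun x => c x == k) D) -> n <= #|` D|.
Proof.
move=> c_onto; rewrite -(size_map c D) -{1}(size_enum_ord n).
apply: uniq_leq_size => [|k _]; first exact: enum_uniq.
by have /hasP[x xD /eqP <-] := c_onto k; apply: map_f.
Qed.

Theorem theorem1p5 (n : nat) (n_gt0 : 0 < n)
    (satisfactory_ex : exists c : nat -> 'I_n, satisfactory c)
    (A : {fset nat}) (A_pos : forall x : nat, x \in A -> 0 < x)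
    (A_odd : odd #|` A|) :
  n <= #|` symdiff (fun l : 'I_n => dilate l.+1 A)|.
Proof.
have [c c_sat] := satisfactory_ex.
apply: (@leq_card_colours _ _ c) => k.
rewrite has_count; apply: odd_gt0; rewrite odd_count_symdiff.
under eq_bigr do rewrite count_dilate.
rewrite exchange_big /= big_seq.
under eq_bigr => a aA do
  rewrite (one_multiple_per_colour a k c_sat (A_pos a aA)).
by rewrite -big_seq sum1_size.
Qed.
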